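(* Let $n>1$ be an integer. Then $$\sum_{k=0}^{n-1}(3k+1)(-16)^{n-k-1}\binom{2k}{k} f_k \equiv 0 \pmod{n\binom{2n}{n}},$$ i.e. the integer on the left is divisible by $n\binom{2n}{n}$.
   Context: The Franel numbers are defined by $f_n=\sum_{k=0}^n \binom{n}{k}^3$ for integers $n\ge 0$. *)

(* Defs.v *)
From HB Require Import structures.
From mathcomp Require Import all_boot all_order all_algebra.
Set Implicit Arguments. Unset Strict Implicit. Unset Printing Implicit Defensive.

Definition franel (n : nat) : nat := \sum_(0 <= k < n.+1) 'C(n, k) ^ 3.

(* Main.v *)
Require Import Defs.
From HB Require Import structures.
From mathcomp Require Import all_boot all_order all_algebra.
From mathcomp Require Import ring lra zify.
Import GRing.Theory Num.Theory.
Local Open Scope ring_scope.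

(** The Franel numbers satisfy
      f_n = \sum_k (-4)^(n-k) C(n+2k,3k) C(3k,k) C(2k,k),
    since by Zeilberger's method both sides obey
      (m+2)^2 a_{m+2} = (7(m+1)^2 + 7(m+1) + 2) a_{m+1} + 8(m+1)^2 a_m.
    After substituting this into the sum S_n of the theorem and exchanging
    summations, the sum over the outer index telescopes for each fixed k, giving
      2 S_n = n C(2n,n) \sum_{k<n} (-4)^(n-1-k) C(3k+1,k) C(2k,k) C(n+2k,3k+1).
    For n > 1 every term of the last sum is even: either its power of -4 is
    nontrivial, or k = n-1 > 0 and C(2k,k) is even. *)

(** Each side condition left by [field] is a hypothesis in context or follows from positivity by
    linear arithmetic, so variables must come with their nonnegativity. *)
Ltac pos_field :=
  field; rewrite ?andbT; repeat (apply/andP; split);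
  by [ | apply: lt0r_neq0; lra ].

Lemma factr_neq0 (R : realFieldType) (n : nat) : (n`!)%:R != 0 :> R.
Proof. by rewrite pnatr_eq0 -lt0n fact_gt0. Qed.

Lemma factrS (R : realFieldType) (n : nat) :
  (n.+1`!)%:R = (n%:R + 1) * (n`!)%:R :> R.
Proof. by rewrite factS natrM -natr1. Qed.

Lemma binr_fact (R : realFieldType) (i j : nat) :
  ('C(i + j, i))%:R = ((i + j)`!)%:R / ((i`!)%:R * (j`!)%:R) :> R.
Proof.
apply: (canRL (mulfK _)); first by rewrite mulf_neq0 // factr_neq0.
by rewrite -!natrM -(bin_fact (leq_addr j i)) addKn.
Qed.

Lemma big_nat_widen0 (V : nmodType) (F : nat -> V) (n p : nat) : (n <= p)%N ->
  (forall k, (n <= k)%N -> F k = 0) ->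
  \sum_(0 <= k < n) F k = \sum_(0 <= k < p) F k.
Proof.
move=> lenp F0; rewrite (big_cat_nat (leq0n n) lenp) /= [X in _ + X]big_nat [X in _ + X]big1 ?addr0 //.
by move=> k /andP[/F0].
Qed.

(** * The Franel recurrence, by creative telescoping *)

Definition franel_comb (R : realFieldType) (x a0 a1 a2 : R) : R :=
  (x + 2) ^+ 2 * a2
  - (7 * (x + 1) ^+ 2 + 7 * (x + 1) + 2) * a1
  - 8 * (x + 1) ^+ 2 * a0.

Definition franel_rec (R : realFieldType) (a : nat -> R) : Prop :=
  forall m, franel_comb R m%:R (a m) (a m.+1) (a m.+2) = 0.

(** The leading coefficient [(m + 2)^2] never vanishes, so two consecutive values determine the
    next. *)
Lemma franel_rec_unique (R : realFieldType) (a b : nat -> R) :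
  franel_rec R a -> franel_rec R b ->
  a 0%N = b 0%N -> a 1%N = b 1%N -> a =1 b.
Proof.
move=> ha hb e0 e1 n; suff [] : a n = b n /\ a n.+1 = b n.+1 by [].
elim: n => [//|n [e e']]; split=> //.
have := etrans (ha n) (esym (hb n)); rewrite /franel_comb e e'.
move=> /addIr/addIr; apply: mulfI.
by rewrite expf_neq0 // -natrD pnatr_eq0 addn2.
Qed.

(* [G m k] is the Zeilberger certificate: the sum over [j <= k] of the recurrence
   operator applied to [F _ j], in closed form for [k <= m]. The terms [k = m.+1]
   and [k = m.+2], where [F m k] vanishes, are treated apart. *)
Lemma franel_rec_sum (R : realFieldType) (F G : nat -> nat -> R) :
    (forall n k, (n < k)%N -> F n k = 0) ->
    (forall m, franel_comb R m%:R (F m 0%N) (F m.+1 0%N) (F m.+2 0%N) = G m 0%N) ->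
    (forall k i, let m := (k.+1 + i)%N in
      G m k + franel_comb R m%:R (F m k.+1) (F m.+1 k.+1) (F m.+2 k.+1) = G m k.+1) ->
    (forall m, G m m + franel_comb R m%:R 0 (F m.+1 m.+1) (F m.+2 m.+1)
               + franel_comb R m%:R 0 0 (F m.+2 m.+2) = 0) ->
  franel_rec R (fun n => \sum_(0 <= k < n.+1) F n k).
Proof.
move=> F0 G0 GS Gm m.
rewrite (@big_nat_widen0 _ (F m) m.+1 m.+3); [|by lia|exact: F0].
rewrite (@big_nat_widen0 _ (F m.+1) m.+2 m.+3); [|by lia|exact: F0].
have -> : franel_comb R m%:R (\sum_(0 <= k < m.+3) F m k)
    (\sum_(0 <= k < m.+3) F m.+1 k) (\sum_(0 <= k < m.+3) F m.+2 k) =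
  \sum_(0 <= k < m.+3) franel_comb R m%:R (F m k) (F m.+1 k) (F m.+2 k).
  by rewrite /franel_comb !mulr_sumr -!sumrB.
have partial k : (k <= m)%N ->
    \sum_(0 <= j < k.+1) franel_comb R m%:R (F m j) (F m.+1 j) (F m.+2 j) = G m k.
  elim: k => [|k IHk] lkm; first by rewrite big_nat1.
  rewrite big_nat_recr // IHk ?(ltnW lkm) //.
  by have := GS k (m - k.+1)%N; rewrite subnKC.
rewrite big_nat_recr // big_nat_recr // partial //=.
by rewrite (F0 m m.+1) ?(F0 m m.+2) ?(F0 m.+1 m.+2).
Qed.

(* Found by fitting a polynomial to the partial sums. *)
Definition bin3_cert (R : realFieldType) (x y : R) : R :=
  -20 + 30 * y - 18 * y ^+ 2 + 4 * y ^+ 3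
  + x * (-93 + 117 * y - 54 * y ^+ 2 + 8 * y ^+ 3)
  + x ^+ 2 * (-173 + 171 * y - 54 * y ^+ 2 + 4 * y ^+ 3)
  + x ^+ 3 * (-161 + 111 * y - 18 * y ^+ 2)
  + x ^+ 4 * (-75 + 27 * y) - 14 * x ^+ 5.

(* Here [x = k], [y = m - k - 1] and [t = m! / (k! (m-k-1)!)]. *)
Lemma bin3_cert_step (R : realFieldType) (x y t : R) : 0 <= x -> 0 <= y ->
  bin3_cert R (x + 1 + y) x * (t / (y + 1) / (x + 1 + y + 1 - x)) ^+ 3
  + franel_comb R (x + 1 + y) ((t / (x + 1)) ^+ 3)
     ((t * (x + y + 2) / ((x + 1) * (y + 1))) ^+ 3)
     ((t * (x + y + 2) * (x + y + 3) / ((x + 1) * (y + 1) * (y + 2))) ^+ 3) =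
  bin3_cert R (x + 1 + y) (x + 1)
  * (t / (x + 1) / (x + 1 + y + 1 - (x + 1))) ^+ 3.
Proof. by rewrite /bin3_cert /franel_comb => x0 y0; pos_field. Qed.

Lemma franel_recurrence (R : realFieldType) :
  franel_rec R (fun n => (franel n)%:R).
Proof.
suff: franel_rec R (fun n => \sum_(0 <= k < n.+1) ('C(n, k))%:R ^+ 3).
  have e n : (franel n)%:R = \sum_(0 <= k < n.+1) ('C(n, k))%:R ^+ 3 :> R.
    by rewrite natr_sum; apply: eq_bigr => k _; rewrite natrX.
  by move=> h m; rewrite !e; apply: h.
(* The denominator [m + 1 - k] is nonzero for [k <= m], the only range where the certificate is
   evaluated. *)
apply: (@franel_rec_sum R _ (fun m k => bin3_cert R m%:R k%:R
  * (('C(m, k))%:R / (m%:R + 1 - k%:R)) ^+ 3)).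
- by move=> n k /bin_small ->; rewrite expr0n.
- move=> m; rewrite !bin0 /franel_comb /bin3_cert.
  by have := ler0n R m; move: (m%:R : R) => x x0; pos_field.
- move=> k i m.
  have em : m%:R = k%:R + 1 + i%:R :> R by rewrite natrD -natr1.
  (* All four binomials are rational multiples of [t], which reduces the step to an identity in [k],
     [i] and [t]. *)
  pose t : R := ((k + i).+1`!)%:R / ((k`!)%:R * (i`!)%:R).
  have x0 := ler0n R k; have y0 := ler0n R i.
  have a0 := factr_neq0 R k; have b0 := factr_neq0 R i.
  have eD : (k + i)%:R = k%:R + i%:R :> R by rewrite natrD.
  have -> : ('C(m, k))%:R = t / (i%:R + 1).
    by rewrite /m addSnnS binr_fact addnS (factrS R i) /t; pos_field.
  have -> : ('C(m, k.+1))%:R = t / (k%:R + 1).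
    by rewrite /m binr_fact addSn (factrS R k) /t; pos_field.
  have -> : ('C(m.+1, k.+1))%:R =
      t * (k%:R + i%:R + 2) / ((k%:R + 1) * (i%:R + 1)).
    rewrite /m -addnS binr_fact addSn addnS (factrS R k) (factrS R i).
    by rewrite (factrS R (k + i).+1) -(natr1 (k + i)) eD /t; pos_field.
  have -> : ('C(m.+2, k.+1))%:R =
      t * (k%:R + i%:R + 2) * (k%:R + i%:R + 3)
      / ((k%:R + 1) * (i%:R + 1) * (i%:R + 2)).
    rewrite /m -!addnS binr_fact addSn !addnS (factrS R k) (factrS R i.+1).
    rewrite (factrS R i) (factrS R (k + i).+2) (factrS R (k + i).+1).
    by rewrite -(natr1 (k + i).+1) -(natr1 (k + i)) -(natr1 i) eD /t; pos_field.
  by rewrite em -(natr1 k); apply: bin3_cert_step.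
- move=> m; rewrite !binn binSn -(natr1 m.+1) -(natr1 m).
  rewrite /franel_comb /bin3_cert.
  by have := ler0n R m; move: (m%:R : R) => x x0; pos_field.
Qed.

(** * The alternating formula for the Franel numbers *)

Definition franel_term (R : pzRingType) (n k : nat) : R :=
  (-4) ^+ (n - k) * ('C(n + 2 * k, 3 * k) * 'C(3 * k, k) * 'C(2 * k, k))%:R.

(** The three binomials collapse to a multinomial coefficient; writing [n = k + j] avoids truncated
    subtraction. *)
Lemma franel_term_fact (R : realFieldType) (k j : nat) :
  franel_term R (k + j) k =
  (-4) ^+ j * ((3 * k + j)`!)%:R / ((j`!)%:R * (k`!)%:R ^+ 3).
Proof.
rewrite /franel_term addKn !natrM.
have -> : (k + j + 2 * k = 3 * k + j)%N by lia.
rewrite binr_fact.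
have -> : (3 * k = k + 2 * k)%N by lia.
rewrite binr_fact.
have -> : (2 * k = k + k)%N by lia.
rewrite binr_fact.
have := factr_neq0 R k; have := factr_neq0 R j; have := factr_neq0 R (k + k).
have := factr_neq0 R (k + (k + k)) => *.
by field; repeat (apply/andP; split).
Qed.

Lemma franel_term_recurrence (R : realFieldType) :
  franel_rec R (fun n => \sum_(0 <= k < n.+1) franel_term R n k).
Proof.
(* The linear factor can be read off at [k = 0]: there the operator applied to [(-4)^m] gives
   [(36 m + 60) (m + 2) (-4)^m]. *)
apply: (@franel_rec_sum R _ (fun m k => (36 * m%:R + 60) * (-4) ^+ (m - k)
  * ((m + 2 * k).+2`!)%:R / (((m - k).+1`!)%:R * (k`!)%:R ^+ 3))).
- move=> n k lt_nk; rewrite /franel_term (@bin_small (n + 2 * k)) ?mul0n ?mulr0 //.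
  by lia.
- move=> m; rewrite !(franel_term_fact R 0) !add0n !fact0 subn0 addn0.
  rewrite !factrS !exprS -(natr1 m).
  have := factr_neq0 R m; have := ler0n R m.
  rewrite /franel_comb.
  by move: (m%:R : R) ((m`!)%:R : R) => x a x0 a0; pos_field.
- move=> k i m.
  have em : m%:R = k%:R + 1 + i%:R :> R by rewrite natrD -natr1.
  rewrite {3}/m franel_term_fact.
  have -> : m.+2 = (k.+1 + i.+2)%N by rewrite !addnS.
  have -> : m.+1 = (k.+1 + i.+1)%N by rewrite addnS.
  rewrite !franel_term_fact em.
  have -> : (m - k = i.+1)%N by rewrite /m; lia.
  have -> : (m - k.+1 = i)%N by rewrite /m; lia.
  (* The large factorials are all expressed through [(3 k + i + 3)!], which then cancels as a common
     factor. *)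
  have -> : ((m + 2 * k).+2 = (3 * k + i).+3)%N by rewrite /m; lia.
  have -> : ((m + 2 * k.+1).+2 = (3 * k + i).+3.+2)%N by rewrite /m; lia.
  have -> : (3 * k.+1 + i = (3 * k + i).+3)%N by lia.
  have -> : (3 * k.+1 + i.+1 = (3 * k + i).+4)%N by lia.
  have -> : (3 * k.+1 + i.+2 = (3 * k + i).+3.+2)%N by lia.
  have es : ((3 * k + i).+3)%N%:R = 3 * k%:R + i%:R + 3 :> R.
    by rewrite -(addn3 (3 * k + i)) natrD natrD natrM.
  rewrite (factrS R (3 * k + i).+4) (factrS R (3 * k + i).+3).
  rewrite -(natr1 (3 * k + i).+3) es (factrS R i.+1) (factrS R i) (factrS R k).
  rewrite -(natr1 i) !exprS.
  have := ler0n R k; have := ler0n R i.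
  have := factr_neq0 R k; have := factr_neq0 R i.
  rewrite /franel_comb.
  move: (k%:R : R) (i%:R : R) ((k`!)%:R : R) ((i`!)%:R : R).
  by move=> x y a b b0 a0 y0 x0; pos_field.
- move=> m.
  have := franel_term_fact R m.+1 0; have := franel_term_fact R m.+1 1.
  have := franel_term_fact R m.+2 0; rewrite !addn1 !addn0 => -> -> ->.
  have -> : (3 * m.+2 = (3 * m).+4.+2)%N by lia.
  have -> : ((3 * m.+1).+1 = (3 * m).+4)%N by lia.
  have -> : (3 * m.+1 = (3 * m).+3)%N by lia.
  have -> : ((m + 2 * m).+2 = (3 * m).+2)%N by lia.
  have es : ((3 * m).+2)%N%:R = 3 * m%:R + 2 :> R by rewrite -(addn2 (3 * m)) natrD natrM.
  rewrite (factrS R (3 * m).+4.+1) (factrS R (3 * m).+4) (factrS R (3 * m).+3).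
  rewrite (factrS R (3 * m).+2) -(natr1 (3 * m).+4) -(natr1 (3 * m).+3).
  rewrite -(natr1 (3 * m).+2) es subnn fact0 (_ : 1`! = 1)%N //.
  rewrite (factrS R m.+1) (factrS R m) -(natr1 m).
  have := ler0n R m; have := factr_neq0 R m.
  rewrite /franel_comb.
  by move: (m%:R : R) ((m`!)%:R : R) => x a a0 x0; pos_field.
Qed.

Lemma franel_alt (R : realFieldType) (n : nat) :
  (franel n)%:R = \sum_(0 <= k < n.+1) franel_term R n k.
Proof.
move: n; apply: (franel_rec_unique _ _ _ (franel_recurrence R) (franel_term_recurrence R)).
- by rewrite /franel !big_nat1 /franel_term !mul1r.
- have -> : franel 1 = 2%N by rewrite /franel !big_nat_recr //= big_geq.
  rewrite !big_nat_recr //= big_geq // /franel_term.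
  rewrite (_ : 'C(1 + 2 * 0, 3 * 0) * 'C(3 * 0, 0) * 'C(2 * 0, 0) = 1)%N //.
  rewrite (_ : 'C(1 + 2 * 1, 3 * 1) * 'C(3 * 1, 1) * 'C(2 * 1, 1) = 6)%N //.
  by rewrite subn0 subnn; ring.
Qed.

(** * The quotient sum *)

(** Stated over any ring: the factorial identities need a field, the divisibility needs [int]. *)
Definition quot_term (R : pzRingType) (n k : nat) : R :=
  (-4) ^+ (n - 1 - k)
  * ('C(3 * k + 1, k) * 'C(2 * k, k) * 'C(n + 2 * k, 3 * k + 1))%:R.

Lemma quot_term_fact (R : realFieldType) (k j : nat) :
  quot_term R (k + j).+1 k =
  (-4) ^+ j * ((3 * k + 1 + j)`!)%:R
  / ((j`!)%:R * (k`!)%:R ^+ 3 * (2 * k%:R + 1)).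
Proof.
rewrite /quot_term subn1 addKn !natrM.
have -> : ((k + j).+1 + 2 * k = 3 * k + 1 + j)%N by lia.
rewrite (binr_fact R (3 * k + 1) j).
have -> : (3 * k + 1 = k + (2 * k).+1)%N by lia.
rewrite (binr_fact R k (2 * k).+1) (factrS R (2 * k)) (natrM _ 2 k).
have -> : (2 * k = k + k)%N by lia.
rewrite (binr_fact R k k).
have := factr_neq0 R k; have := factr_neq0 R j; have := factr_neq0 R (k + k).
have := factr_neq0 R (k + (k + k).+1); have := ler0n R k => *.
by pos_field.
Qed.

(** Multiplied by [2 C(2n,n)], this is the contribution of a fixed [k] to the step from [n] to
    [n + 1] in the closed form of [2 S_n]. *)
Lemma quot_term_step (R : realFieldType) (n k : nat) : (k <= n)%N ->
  (2 * n%:R + 1) * quot_term R n.+1 k =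
  (3 * n%:R + 1) * franel_term R n k - 8 * n%:R * quot_term R n k.
Proof.
move=> /subnKC; move: (n - k)%N => j <-.
rewrite quot_term_fact franel_term_fact addn1 addSn factrS.
have x0 := ler0n R k; have a0 := factr_neq0 R k.
(* For [k = n] the last term vanishes, and [quot_term_fact] covers only [k < n]. *)
case: j => [|j].
  rewrite addn0 /quot_term (@bin_small (k + 2 * k)) ?muln0 ?mulr0; last by lia.
  rewrite !addn0 natrM fact0; move: (k%:R : R) ((k`!)%:R : R) x0 a0 => x a x0 a0.
  by pos_field.
have es : ((3 * k + j).+1)%N%:R = 3 * k%:R + j%:R + 1 :> R.
  by rewrite -(natr1 (3 * k + j)) natrD natrM.
rewrite addnS quot_term_fact addn1 addSn addnS (factrS R j) exprS.
rewrite es -(natr1 (k + j)) natrD.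
have := ler0n R j; have := factr_neq0 R j.
move: (k%:R : R) (j%:R : R) ((k`!)%:R : R) ((j`!)%:R : R) x0 a0.
by move=> x y a b x0 a0 b0 y0; pos_field.
Qed.

Lemma quot_sum_step (R : realFieldType) (n : nat) :
  (2 * n%:R + 1) * (\sum_(0 <= k < n.+1) quot_term R n.+1 k) =
  (3 * n%:R + 1) * (franel n)%:R
  - 8 * n%:R * \sum_(0 <= k < n) quot_term R n k.
Proof.
rewrite franel_alt (@big_nat_widen0 _ (quot_term R n) n n.+1) //; last first.
  move=> k lenk; rewrite /quot_term (@bin_small (n + 2 * k)) ?muln0 ?mulr0 //.
  by lia.
rewrite !mulr_sumr -sumrB big_nat [RHS]big_nat.
by apply: eq_bigr => k /andP[_ lekn]; apply: quot_term_step.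
Qed.

Lemma central_binS (n : nat) :
  (n.+1 * 'C(2 * n.+1, n.+1) = 2 * (2 * n).+1 * 'C(2 * n, n))%N.
Proof.
have e1 : (2 * n.+1 = (2 * n).+2)%N by lia.
have e2 : ((2 * n).+1 - n = n.+1)%N by lia.
by rewrite e1 -mul_bin_diag succnK -e1 -!mulnA -[in LHS]e2 -mul_bin_down succnK.
Qed.

(** Both sides vanish at 0 and satisfy [u_{n+1} = -16 u_n + 2 (3n+1) C(2n,n) f_n]. *)
Lemma franel_sum_quot (R : realFieldType) (n : nat) :
  2 * \sum_(0 <= k < n) ((3 * k + 1)%N%:R * (-16) ^+ (n - k - 1)
        * ('C(2 * k, k))%:R * (franel k)%:R) =
  (n * 'C(2 * n, n))%N%:R * \sum_(0 <= k < n) quot_term R n k.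
Proof.
elim: n => [|n IHn]; first by rewrite !big_geq // !mulr0.
rewrite central_binS big_nat_recr //= subSn // subnn subn1 expr0.
have -> : \sum_(0 <= k < n) ((3 * k + 1)%N%:R * (-16) ^+ (n.+1 - k - 1)
      * ('C(2 * k, k))%:R * (franel k)%:R) =
    -16 * \sum_(0 <= k < n) ((3 * k + 1)%N%:R * (-16) ^+ (n - k - 1)
      * ('C(2 * k, k))%:R * (franel k)%:R) :> R.
  rewrite mulr_sumr big_nat [RHS]big_nat; apply: eq_bigr => k /andP[_ ltkn].
  have -> : (n.+1 - k - 1 = (n - k - 1).+1)%N by lia.
  by rewrite exprS; ring.
have eS : (2 * (2 * n).+1 * 'C(2 * n, n))%N%:R =
    2 * ('C(2 * n, n))%:R * (2 * n%:R + 1) :> R.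
  by rewrite natrM natrM -(natr1 (2 * n)) (natrM _ 2 n); ring.
rewrite eS -[RHS]mulrA quot_sum_step mulrDr (mulrCA 2 (-16)) IHn natrM natrD.
rewrite (natrM _ 3 n).
by ring.
Qed.

(** * Parity and divisibility *)

(** Pascal's rule splits [C(2k,k)] into two terms that are equal by symmetry. *)
Lemma central_bin_even (k : nat) : (0 < k)%N -> (2 %| 'C(2 * k, k))%N.
Proof.
case: k => // k _; rewrite (_ : (2 * k.+1 = (2 * k).+2)%N); last by lia.
rewrite binS -(@bin_sub _ k.+1); last by lia.
by rewrite (_ : ((2 * k).+1 - k.+1 = k)%N) ?addnn -?muln2 ?dvdn_mull //; lia.
Qed.

Lemma quot_term_intr (R : realFieldType) (n k : nat) :
  (quot_term int n k)%:~R = quot_term R n k.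
Proof. by rewrite /quot_term rmorphM rmorphXn rmorphN !rmorph_nat. Qed.

Lemma quot_sum_even (n : nat) : (1 < n)%N ->
  (2 %| \sum_(0 <= k < n) quot_term int n k)%Z.
Proof.
move=> n1; rewrite big_nat; apply: rpred_sum => k /andP[_ ltkn].
(* For [k = 0] the exponent [n - 1] is positive; for [k > 0] the central binomial is even whatever
   the exponent. *)
have [k0|k0] := posnP k.
  rewrite /quot_term k0 (_ : (n - 1 - 0 = (n - 2).+1)%N); last by lia.
  by rewrite exprS -mulrA dvdz_mulr.
apply: dvdz_mull; rewrite [X in (_ %| X)%Z]natz dvdzE absz_nat.
by apply: dvdn_mulr; apply: dvdn_mull; apply: central_bin_even.
Qed.

Theorem theorem1p1 (n : nat) (hn : (1 < n)%N) :
  ((n * 'C(2 * n, n))%N%:Z %|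
     \sum_(0 <= k < n)
        ((3 * k + 1)%N%:Z * (-16 : int) ^+ (n - k - 1) *
         ('C(2 * k, k))%:Z * (franel k)%:Z))%Z.
Proof.
set S := \sum_(0 <= k < n) _.
have eS : 2 * S = (n * 'C(2 * n, n))%N%:Z * \sum_(0 <= k < n) quot_term int n k.
  (* The closed form is available over a field, so the identity is transferred back from [rat]. *)
  apply: (@intr_inj rat); rewrite [LHS]rmorphM [RHS]rmorphM /= !rmorph_sum /=.
  under [in RHS]eq_bigr do rewrite quot_term_intr.
  rewrite -[(n * _)%N%:~R]pmulrn -franel_sum_quot; congr (_ * _).
  by apply: eq_bigr => k _; rewrite !rmorphM /= rmorphXn /= rmorphN -!pmulrn.
have /dvdzP[q eq] := quot_sum_even n hn.
apply/dvdzP; exists q; apply: (@mulfI _ (2 : int)) => //.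
by rewrite eS eq; ring.
Qed.
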